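(* Let $d,m,k\ge 1$ be integers, let $L,\beta,\varepsilon>0$ and $0<\eta\le 2/\beta$. Let $Z$ be a set of examples and $\ell:\mathbb{R}^d\times Z\to\mathbb{R}$ a loss function such that for every $z\in Z$ the function $\ell(\cdot,z)$ is convex, $L$-Lipschitz and $\beta$-smooth on $\mathbb{R}^d$. Consider the randomized algorithm (Private Convex Permutation-based SGD) which on input $S\in Z^m$ does the following: it runs $k$-pass PSGD on $S$ with constant step size $\eta_t=\eta$ for all $t$, from a fixed data-independent starting point $w_0\in\mathbb{R}^d$ and with a uniformly random permutation of $[m]$, obtaining the last iterate $w=w_{km}$; it sets $\Delta_2=2kL\eta$; it draws, independently of the permutation, a noise vector $\kappa\in\mathbb{R}^d$ with density $p(\kappa)\propto\exp(-\varepsilon\|\kappa\|/\Delta_2)$; and it outputs $w+\kappa$. Then this algorithm is $\varepsilon$-differentially private.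
   Context: $\|\cdot\|$ is the Euclidean norm and $[m]=\{1,\dots,m\}$. A differentiable $f:\mathbb{R}^d\to\mathbb{R}$ is convex if $f(u)\ge f(v)+\langle\nabla f(v),u-v\rangle$ for all $u,v$; $L$-Lipschitz if $|f(u)-f(v)|\le L\|u-v\|$; $\beta$-smooth if $\|\nabla f(u)-\nabla f(v)\|\le\beta\|u-v\|$. $k$-pass PSGD (permutation-based SGD) on $S=(z_1,\dots,z_m)\in Z^m$ with permutation $r$ of $[m]$, step sizes $\eta_1,\dots,\eta_{km}$ and starting point $w_0$: for $t=1,\dots,km$ write $t=s+jm$ with $1\le s\le m$, $0\le j\le k-1$, and set $w_t=w_{t-1}-\eta_t\nabla\ell(w_{t-1},z_{r^{-1}(s)})$ (gradient in the first argument). Thus the data point with index $i$ is processed exactly at steps $r(i)+jm$, $j=0,\dots,k-1$. Two datasets $S,S'\in Z^m$ are neighboring, $S\sim S'$, if they differ in a single entry. A randomized algorithm $A$ is $\varepsilon$-differentially private if $\Pr[A(S)\in E]\le e^{\varepsilon}\Pr[A(S')\in E]$ for all neighboring $S,S'$ and all (measurable) events $E$. *)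

(* Defs.v *)
From HB Require Import structures.
From mathcomp Require Import all_boot all_order all_algebra all_fingroup.
From mathcomp Require Import all_classical all_reals all_analysis.

Set Implicit Arguments.
Unset Strict Implicit.
Unset Printing Implicit Defensive.

Import Order.TTheory GRing.Theory Num.Theory.
Import numFieldNormedType.Exports.

Local Open Scope classical_set_scope.
Local Open Scope ring_scope.

(* The library's norm on ['rV[R]_n] is the sup norm, hence a separate
   Euclidean norm; [differentiable] is the same for both. *)
Definition dotv (R : realType) (n : nat) (u v : 'rV[R]_n) : R :=
  \sum_i u 0 i * v 0 i.

Definition enorm (R : realType) (n : nat) (u : 'rV[R]_n) : R :=
  Num.sqrt (dotv u u).

Definition gradient (R : realType) (n : nat) (f : 'rV[R]_n -> R)
    (u : 'rV[R]_n) : 'rV[R]_n :=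
  \row_i 'D_(delta_mx 0 i) f u.

(* First-order convexity, meaningful for differentiable functions. *)
Definition convex1 (R : realType) (n : nat) (f : 'rV[R]_n -> R) : Prop :=
  forall u v, f u >= f v + dotv (gradient f v) (u - v).

Definition elipschitz (R : realType) (n : nat) (L : R) (f : 'rV[R]_n -> R)
    : Prop :=
  forall u v, `|f u - f v| <= L * enorm (u - v).

Definition smooth (R : realType) (n : nat) (beta : R) (f : 'rV[R]_n -> R)
    : Prop :=
  forall u v, enorm (gradient f u - gradient f v) <= beta * enorm (u - v).

Definition measure_rV_display : measure_display -> measure_display.
Proof. exact. Qed.

Section measurable_rV.
Context {d} {T : measurableType d}.
Variable n : nat.

(* Generated by the coordinates, like the library's structure on [n.-tuple T];
   for [T = R] this is the Borel sigma-algebra of R^n. *)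
Let coors : 'I_n -> 'rV[T]_n -> T := fun i v => v 0 i.

Let rV_set0 : g_sigma_preimage coors set0.
Proof. exact: sigma_algebra0. Qed.

Let rV_setC A : g_sigma_preimage coors A -> g_sigma_preimage coors (~` A).
Proof. exact: sigma_algebraC. Qed.

Let rV_bigcup (F : _^nat) : (forall i, g_sigma_preimage coors (F i)) ->
  g_sigma_preimage coors (\bigcup_i (F i)).
Proof. exact: sigma_algebra_bigcup. Qed.

HB.instance Definition _ := @isMeasurable.Build (measure_rV_display d)
  'rV[T]_n (g_sigma_preimage coors) rV_set0 rV_setC rV_bigcup.

End measurable_rV.

Lemma measurable_coord_rV d (T : measurableType d) n (i : 'I_n) :
  measurable_fun [set: 'rV[T]_n] (fun v : 'rV[T]_n => v 0 i).
Proof.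
move=> _ Y mY; rewrite setTI; apply: sub_sigma_algebra => /=.
rewrite -bigcup_seq/=; exists i => /=; first by rewrite mem_index_enum.
by exists Y => //; rewrite setTI.
Qed.

Lemma measurable_fun_rVP d1 d2 (T1 : measurableType d1)
    (T2 : measurableType d2) n (f : T1 -> 'rV[T2]_n) :
  measurable_fun [set: T1] f <->
  forall i, measurable_fun [set: T1] (fun x => f x 0 i).
Proof.
split=> [mf i|mf].
  exact: (measurableT_comp (measurable_coord_rV i)).
move=> _ A mA; rewrite setTI.
pose G := [set B : set 'rV[T2]_n | measurable (f @^-1` B)].
have mG : (@measurable _ 'rV[T2]_n) `<=` G; last exact: mG.
apply: smallest_sub.
  split.
  - by rewrite /G/= preimage_set0; exact: measurable0.
  - by move=> B; rewrite /G/= setTD -preimage_setC; exact: measurableC.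
  - by move=> F mF; rewrite /G/= preimage_bigcup; exact: bigcupT_measurable.
rewrite -bigcup_seq => B [i _ [C mC <-]]; rewrite /G/= setTI.
by rewrite -[X in measurable X]setTI; exact: (mf i).
Qed.

Definition rV_cons (R : realType) (n : nat) (p : measurableTypeR R * 'rV[R]_n)
  : 'rV[R]_n.+1 := row_mx (const_mx p.1 : 'rV_1) p.2.

Lemma rV_cons0 (R : realType) n p : @rV_cons R n p 0 ord0 = p.1.
Proof.
rewrite /rV_cons (_ : ord0 = lshift n (ord0 : 'I_1)); last exact/val_inj.
exact: (etrans (row_mxEl _ _ _ _) (mxE _ _ _ _)).
Qed.

Lemma rV_consS (R : realType) n p j :
  @rV_cons R n p 0 (lift ord0 j) = p.2 0 j.
Proof.
rewrite /rV_cons (_ : lift ord0 j = rshift 1 j); last exact/val_inj.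
exact: row_mxEr.
Qed.

Lemma measurable_rV_cons (R : realType) n :
  measurable_fun [set: measurableTypeR R * 'rV[R]_n] (@rV_cons R n).
Proof.
apply/measurable_fun_rVP => i; case: (unliftP ord0 i) => [j|] ->.
  rewrite (_ : (fun x => _) = (fun v : 'rV[R]_n => v 0 j) \o snd).
    apply: measurableT_comp; first exact: measurable_coord_rV.
    exact: measurable_snd.
  by apply/funext => x; rewrite rV_consS.
rewrite (_ : (fun x => _) = fst); first exact: measurable_fst.
by apply/funext => x; rewrite rV_cons0.
Qed.

Lemma sigma_finite_product d1 d2 (T1 : measurableType d1)
    (T2 : measurableType d2) (R : realType)
    (m1 : {sigma_finite_measure set T1 -> \bar R})
    (m2 : {sigma_finite_measure set T2 -> \bar R}) :
  sigma_finite setT (m1 \x m2)%E.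
Proof.
have /sigma_finiteP[F [TF ndF Foo]] := sigma_finiteT m1.
have /sigma_finiteP[G [TG ndG Goo]] := sigma_finiteT m2.
exists (fun n => F n `*` G n).
  rewrite -setXTT TF TG predeqE => -[x y]; split.
    move=> [/= [n _ Fnx] [k _ Gky]]; exists (maxn n k) => //; split.
    - by move: x Fnx; exact/subsetPset/ndF/leq_maxl.
    - by move: y Gky; exact/subsetPset/ndG/leq_maxr.
  by move=> [n _ []/= ? ?]; split; exists n.
move=> k; have [? ?] := Foo k; have [? ?] := Goo k.
split; first exact: measurableX.
by rewrite product_measure1E// lte_mul_pinfty// ge0_fin_numE.
Qed.

Section lebesgue_rV_succ.
Context (R : realType) (n : nat).
Variable mu : {sigma_finite_measure set 'rV[R]_n -> \bar R}.

Definition lebesgue_rV_succ : set 'rV[R]_n.+1 -> \bar R :=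
  pushforward (@lebesgue_measure R \x mu)%E (@rV_cons R n).

Let mcons := @measurable_rV_cons R n.

Let succ0 : lebesgue_rV_succ set0 = 0%E.
Proof. by rewrite /lebesgue_rV_succ /pushforward preimage_set0 measure0. Qed.

Let succ_ge0 A : (0 <= lebesgue_rV_succ A)%E.
Proof. exact: measure_ge0. Qed.

Let succ_sigma_additive : semi_sigma_additive lebesgue_rV_succ.
Proof.
pose m := measure_function_pushforward__canonical__measure_function_Measure
  (@lebesgue_measure R \x mu)%E mcons.
exact: (@measure_semi_sigma_additive _ _ _ m).
Qed.

HB.instance Definition _ := isMeasure.Build _ _ _ lebesgue_rV_succ
  succ0 succ_ge0 succ_sigma_additive.

Let succ_sigma_finite : sigma_finite setT lebesgue_rV_succ.
Proof.
have [F FT mF] : sigma_finite setT (@lebesgue_measure R \x mu)%E.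
  exact: (sigma_finite_product (@lebesgue_measure R)).
pose hd (v : 'rV[R]_n.+1) : measurableTypeR R * 'rV[R]_n :=
  (v 0 ord0, \row_j v 0 (lift ord0 j)).
have hdK : cancel (@rV_cons R n) hd.
  case=> x v; rewrite /hd rV_cons0; congr pair.
  by apply/rowP => j; rewrite mxE rV_consS.
have mhd : measurable_fun [set: 'rV[R]_n.+1] hd.
  apply/measurable_fun_pair; first exact: measurable_coord_rV.
  apply/measurable_fun_rVP => j.
  rewrite (_ : (fun x => _) = (fun v : 'rV[R]_n.+1 => v 0 (lift ord0 j))).
    exact: measurable_coord_rV.
  by apply/funext => v; rewrite mxE.
exists (fun k => hd @^-1` F k).
  by rewrite -preimage_bigcup -FT.
move=> k; have [mFk Fk] := mF k; split.
  by rewrite -[X in measurable X]setTI; exact: mhd.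
rewrite /lebesgue_rV_succ /pushforward (_ : _ @^-1` _ = F k)//.
by apply/seteqP; split => p /=; rewrite hdK.
Qed.

HB.instance Definition _ := Measure_isSigmaFinite.Build _ _ _
  lebesgue_rV_succ succ_sigma_finite.

End lebesgue_rV_succ.

(* Lebesgue measure on R^n as the n-fold product of Lebesgue measure on R. *)
Fixpoint lebesgue_rV (R : realType) (n : nat)
    : {sigma_finite_measure set 'rV[R]_n -> \bar R} :=
  match n with
  | 0 => \d_(0 : 'rV[R]_0)
  | n'.+1 => lebesgue_rV_succ (lebesgue_rV R n')
  end.

HB.instance Definition _ (T : finType) := isPointed.Build (perm_type T) 1%g.

HB.instance Definition _ (T : finType) :=
  @isMeasurable.Build default_measure_display (perm_type T) discrete_measurable
    discrete_measurable0 discrete_measurableC discrete_measurableU.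

Definition uniform_perm (R : realType) (dO : measure_display)
    (Omega : measurableType dO) (P : probability Omega R) (m : nat)
    (r : {RV P >-> 'S_m}) : Prop :=
  forall s : 'S_m, distribution P r [set s] = (m`!%:R^-1)%:E.

Definition independent_RV (R : realType) (dO d1 d2 : measure_display)
    (Omega : measurableType dO) (T1 : measurableType d1)
    (T2 : measurableType d2) (P : probability Omega R)
    (X : {RV P >-> T1}) (Y : {RV P >-> T2}) : Prop :=
  forall A B, measurable A -> measurable B ->
    P (X @^-1` A `&` Y @^-1` B) = (P (X @^-1` A) * P (Y @^-1` B))%E.

Definition has_density (R : realType) (dO : measure_display)
    (Omega : measurableType dO) (P : probability Omega R) (n : nat)
    (X : {RV P >-> 'rV[R]_n}) (p : 'rV[R]_n -> R) : Prop :=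
  [/\ measurable_fun setT p, forall x, 0 <= p x &
      forall A, measurable A ->
        distribution P X A = (\int[lebesgue_rV R n]_(x in A) (p x)%:E)%E].

Definition density_propto (R : realType) (dO : measure_display)
    (Omega : measurableType dO) (P : probability Omega R) (n : nat)
    (X : {RV P >-> 'rV[R]_n}) (g : 'rV[R]_n -> R) : Prop :=
  exists2 c : R, 0 < c & has_density X (fun x => c * g x).

Definition neighboring (Z : Type) (m : nat) (S S' : m.-tuple Z) : Prop :=
  exists2 i : 'I_m, tnth S i <> tnth S' i &
    forall j, j != i -> tnth S j = tnth S' j.

(* A randomized algorithm is given by the law of its output on each dataset. *)
Definition differentially_private (R : realType) (dY : measure_display)
    (Y : measurableType dY) (Z : Type) (m : nat) (eps : R)
    (A : m.-tuple Z -> probability Y R) : Prop :=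
  forall S S' : m.-tuple Z, neighboring S S' ->
  forall E : set Y, measurable E -> (A S E <= (expR eps)%:E * A S' E)%E.

(* [psgd .. t] is the iterate w_t.  Step [t.+1 = s + j * m] with
   [1 <= s <= m] has [s - 1 = t %% m], the 0-based position in the pass, and
   both positions and data indices are 0-based.  The last iterate of the
   k-pass algorithm is [psgd .. (k * m)]. *)
Fixpoint psgd (R : realType) (n m : nat) (m_gt0 : (0 < m)%N) (Z : Type)
    (loss : 'rV[R]_n -> Z -> R) (eta : nat -> R) (w0 : 'rV[R]_n)
    (S : m.-tuple Z) (r : 'S_m) (t : nat) : 'rV[R]_n :=
  match t with
  | 0 => w0
  | t'.+1 =>
    let w := psgd m_gt0 loss eta w0 S r t' in
    let s := Ordinal (ltn_pmod t' m_gt0) in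
    w - eta t'.+1 *: gradient (loss^~ (tnth S (r^-1%g s))) w
  end.

Section private_psgd.
Context (R : realType) (dO : measure_display) (Omega : measurableType dO)
  (P : probability Omega R) (n m k : nat) (m_gt0 : (0 < m)%N) (Z : Type).
Variables (loss : 'rV[R]_n -> Z -> R) (eta : R) (w0 : 'rV[R]_n).
Variables (r : {RV P >-> 'S_m}) (kappa : {RV P >-> 'rV[R]_n}).

Definition private_psgd (S : m.-tuple Z) (omega : Omega) : 'rV[R]_n :=
  psgd m_gt0 loss (fun=> eta) w0 S (r omega) (k * m) + kappa omega.

Let measurable_private_psgd S : measurable_fun setT (private_psgd S).
Proof.
apply/measurable_fun_rVP => i.
rewrite (_ : (fun x => _) = (fun x =>
    psgd m_gt0 loss (fun=> eta) w0 S (r x) (k * m) 0 i + kappa x 0 i)).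
  apply: measurable_realfun.measurable_funD.
    apply: (@measurableT_comp _ _ _ _ _ _ (fun s : 'S_m =>
      psgd m_gt0 loss (fun=> eta) w0 S s (k * m) 0 i)) => //.
  by apply: (measurableT_comp (measurable_coord_rV i)).
by apply/funext => x; rewrite mxE.
Qed.

HB.instance Definition _ S := isMeasurableFun.Build _ _ _ _ (private_psgd S)
  (measurable_private_psgd S).

End private_psgd.

(* Main.v *)
(* For a step size at most 2 / beta, one gradient step on a convex beta-smooth
   function is nonexpansive, by co-coercivity of the gradient.  Hence two runs of
   PSGD on neighboring datasets with the same permutation drift apart only at the
   k steps that process the differing entry, by at most 2 L eta each, since
   gradients have norm at most L.  The last iterates are therefore within
   Delta2 = 2 k L eta, and by translation invariance of Lebesgue measure the
   densities of the two noisy outputs have ratio at most exp eps.  Privacy for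
   each fixed permutation survives averaging, the noise being independent of the
   permutation. *)
Require Import Defs.
From HB Require Import structures.
From mathcomp Require Import all_boot all_order all_algebra all_fingroup.
From mathcomp Require Import all_classical all_reals all_analysis.
From mathcomp Require Import ring lra.

Set Implicit Arguments.
Unset Strict Implicit.
Unset Printing Implicit Defensive.

Import Order.TTheory GRing.Theory Num.Theory.
Import numFieldNormedType.Exports measurable_realfun.

Local Open Scope classical_set_scope.
Local Open Scope ring_scope.

(** * Euclidean inner product and norm *)

Section euclidean.
Context (R : realType) (n : nat).
Implicit Types (u v w : 'rV[R]_n) (a : R).

Lemma dotvC u v : dotv u v = dotv v u.
Proof. by apply: eq_bigr => i _; rewrite mulrC. Qed.

Lemma dotvDl u v w : dotv (u + v) w = dotv u w + dotv v w.
Proof. by rewrite -big_split; apply: eq_bigr => i _; rewrite mxE mulrDl. Qed.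

Lemma dotvZl a u w : dotv (a *: u) w = a * dotv u w.
Proof. by rewrite mulr_sumr; apply: eq_bigr => i _; rewrite mxE mulrA. Qed.

Lemma dotvNl u w : dotv (- u) w = - dotv u w.
Proof. by rewrite -scaleN1r dotvZl mulN1r. Qed.

Lemma dotvDr u v w : dotv w (u + v) = dotv w u + dotv w v.
Proof. by rewrite !(dotvC w) dotvDl. Qed.

Lemma dotvZr a u w : dotv w (a *: u) = a * dotv w u.
Proof. by rewrite !(dotvC w) dotvZl. Qed.

Lemma dotvNr u w : dotv w (- u) = - dotv w u.
Proof. by rewrite !(dotvC w) dotvNl. Qed.

Definition dotvE := (dotvDl, dotvDr, dotvNl, dotvNr, dotvZl, dotvZr).

Lemma dotv_ge0 u : 0 <= dotv u u.
Proof. by apply: sumr_ge0 => i _; rewrite -expr2 sqr_ge0. Qed.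

Lemma dotv_eq0 u : (dotv u u == 0) = (u == 0).
Proof.
apply/eqP/eqP => [/eqP|->]; last by rewrite -(scale0r 0) dotvZl mul0r.
rewrite psumr_eq0 => [/allP u0|i _]; last by rewrite -expr2 sqr_ge0.
apply/rowP => i; rewrite mxE.
by have /implyP/(_ isT) := u0 i (mem_index_enum i); rewrite mulf_eq0 orbb => /eqP.
Qed.

Lemma enorm_ge0 u : 0 <= enorm u.
Proof. exact: sqrtr_ge0. Qed.

Lemma enorm_sqr u : enorm u ^+ 2 = dotv u u.
Proof. by rewrite sqr_sqrtr ?dotv_ge0. Qed.

Lemma enorm_eq0 u : (enorm u == 0) = (u == 0).
Proof. by rewrite sqrtr_eq0 -dotv_eq0 [RHS]eq_le dotv_ge0 andbT. Qed.

Lemma enormN u : enorm (- u) = enorm u.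
Proof. by rewrite /enorm !dotvE opprK. Qed.

Lemma enorm_distC u v : enorm (u - v) = enorm (v - u).
Proof. by rewrite -opprB enormN. Qed.

Lemma enormZ a u : enorm (a *: u) = `|a| * enorm u.
Proof.
by rewrite /enorm !dotvE mulrA -expr2 sqrtrM ?sqr_ge0// sqrtr_sqr.
Qed.

(** Cauchy-Schwarz: for nonzero vectors, expand the nonnegative square of
    [enorm v *: u - enorm u *: v] and cancel [enorm u * enorm v]. *)
Lemma dotv_le_enorm u v : dotv u v <= enorm u * enorm v.
Proof.
have [->|u0] := eqVneq u 0.
  by rewrite -(scale0r 0) dotvZl mul0r mulr_ge0 ?enorm_ge0.
have [->|v0] := eqVneq v 0.
  by rewrite -(scale0r 0) dotvZr mul0r mulr_ge0 ?enorm_ge0.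
have uv0 : 0 < enorm u * enorm v.
  by rewrite mulr_gt0// lt_def enorm_ge0 enorm_eq0 ?u0 ?v0.
rewrite -(ler_pM2l uv0).
have := dotv_ge0 (enorm v *: u - enorm u *: v).
rewrite !dotvE -!enorm_sqr (dotvC v u); lra.
Qed.

Lemma enormD u v : enorm (u + v) <= enorm u + enorm v.
Proof.
rewrite -(@ler_pXn2r _ 2) ?nnegrE ?addr_ge0 ?enorm_ge0//.
rewrite sqrrD !enorm_sqr !dotvE (dotvC v u); have := dotv_le_enorm u v; lra.
Qed.

End euclidean.

(** * Gradient steps on smooth convex functions *)

Section gradient_step.
Context (R : realType) (n : nat) (f : 'rV[R]_n -> R).
Implicit Types u v w : 'rV[R]_n.
Local Notation G := (gradient f).
Hypothesis f_convex : convex1 f.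

(** Moving from [u] by [G u] itself raises [f] by at least [enorm (G u) ^+ 2] by convexity, and by
    at most [L * enorm (G u)] by the Lipschitz bound. *)
Lemma enorm_gradient_le (L : R) u : 0 < L -> elipschitz L f -> enorm (G u) <= L.
Proof.
move=> L0 /(_ (u + G u) u); have := f_convex (u + G u) u.
rewrite [_ + _ - _]addrAC subrr add0r -enorm_sqr => cvx.
move=> /(le_trans (ler_norm _)) lip.
have [->|G0] := eqVneq (enorm (G u)) 0; first exact: ltW.
have {}G0 : 0 < enorm (G u) by rewrite lt_def G0 enorm_ge0.
rewrite -(ler_pM2r G0); lra.
Qed.

Variable beta : R.
Hypotheses (beta_gt0 : 0 < beta) (f_smooth : smooth beta f).

Let dot_gradientB u v w :
  dotv (G u - G v) w <= beta * enorm (u - v) * enorm w.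
Proof.
by apply: le_trans (dotv_le_enorm _ _) _; rewrite ler_wpM2r ?enorm_ge0.
Qed.

(* Convexity alone gives the bound with beta in place of beta / 2; going through
   the midpoint of u and v turns a constant c into beta / 4 + c / 2, and these
   converge to beta / 2. *)
Let descent_approx i u v :
  f v <= f u + dotv (G u) (v - u) +
         (beta / 2 + beta / 2 / 2 ^+ i) * enorm (v - u) ^+ 2.
Proof.
elim: i u v => [|i IH] u v.
  have := dot_gradientB v u (v - u); have := f_convex u v.
  rewrite expr0 divr1 expr2 !dotvE; lra.
set h := v - u; pose w := u + 2^-1 *: h.
have wu : w - u = 2^-1 *: h by rewrite /w addrAC subrr add0r.
have vw : v - w = 2^-1 *: h.
  by apply/rowP => j; rewrite !mxE; field.
have := IH u w; have := IH w v; have := dot_gradientB w u (2^-1 *: h).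
rewrite wu vw enormZ normfV ger0_norm// (exprS 2) invfM.
move: (2 ^+ i)^-1 (enorm h) => c a; rewrite !dotvE; lra.
Qed.

Lemma descent u v :
  f v <= f u + dotv (G u) (v - u) + beta / 2 * enorm (v - u) ^+ 2.
Proof.
apply/ler_addgt0Pr => e e0.
set K := beta / 2 * enorm (v - u) ^+ 2.
have K0 : 0 <= K by rewrite mulr_ge0 ?sqr_ge0// divr_ge0// ltW.
have [i Ki] : exists i : nat, K / 2 ^+ i <= e.
  (* The excess of [descent_approx] over the claimed bound is [K / 2 ^+ i], and here
     [K / e < i < 2 ^+ i]. *)
  pose i := (Num.truncn (K / e)).+1; exists i.
  rewrite ler_pdivrMr ?exprn_gt0// mulrC -ler_pdivrMr//.
  apply/ltW/(lt_le_trans (truncnS_gt _)).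
  by rewrite -natrX ler_nat ltnW// ltn_expl.
have := descent_approx i u v; move: Ki; rewrite /K.
move: (2 ^+ i)^-1 (enorm (v - u)) => c a; lra.
Qed.

(** [g] is the gradient at [v] of [f] minus its linear part at [u], and [y] is a step of length
    [beta^-1] against it. Bound [f y] from below by convexity at [u] and from above by [descent]
    from [v]. *)
Let cocoercive_half u v :
  f u + dotv (G u) (v - u) + (2 * beta)^-1 * enorm (G v - G u) ^+ 2 <= f v.
Proof.
pose g := G v - G u; pose y := v - beta^-1 *: g.
have := f_convex y u; have := descent v y.
have -> : y - v = - (beta^-1 *: g) by rewrite /y addrAC subrr add0r.
have -> : y - u = (v - u) - beta^-1 *: g by rewrite /y addrAC.
rewrite enormN enormZ exprMn real_normK ?num_real// enorm_sqr -/g.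
have -> : (2 * beta)^-1 = beta^-1 / 2 by field; rewrite gt_eqF.
have -> : beta / 2 * (beta^-1 ^+ 2 * dotv g g) = beta^-1 / 2 * dotv g g.
  by field; rewrite gt_eqF.
have -> : dotv g g = dotv (G v) g - dotv (G u) g by rewrite {1}/g !dotvE.
rewrite !(dotvDr (v - u)) !dotvNr !dotvZr; lra.
Qed.

(** Adding the two instances of [cocoercive_half] with [u] and [v] exchanged cancels the function
    values. *)
Lemma gradient_cocoercive u v :
  beta^-1 * enorm (G u - G v) ^+ 2 <= dotv (G u - G v) (u - v).
Proof.
have := cocoercive_half u v; have := cocoercive_half v u.
rewrite (enorm_distC (G v)).
have -> : (2 * beta)^-1 = beta^-1 / 2 by field; rewrite gt_eqF.
rewrite !dotvE; lra.
Qed.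

(** With [g] the gradient difference and [h = u - v], the squared distance changes by
    [eta ^+ 2 * dotv g g - 2 * eta * dotv g h], which co-coercivity makes nonpositive as
    [eta <= 2 / beta]. *)
Lemma gradient_step_nonexpansive eta u v : 0 < eta -> eta <= 2 / beta ->
  enorm ((u - eta *: G u) - (v - eta *: G v)) <= enorm (u - v).
Proof.
move=> eta0 etab; rewrite -(@ler_pXn2r _ 2) ?nnegrE ?enorm_ge0//.
have -> : (u - eta *: G u) - (v - eta *: G v) = (u - v) - eta *: (G u - G v).
  by apply/rowP => j; rewrite !mxE; ring.
have := gradient_cocoercive u v.
rewrite !enorm_sqr; move: (G u - G v) (u - v) => g h coc.
suff : eta * (eta * dotv g g) <= eta * (2 * dotv g h).
  by rewrite !dotvE (dotvC h g); lra.
rewrite ler_pM2l//.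
apply: le_trans (_ : 2 / beta * dotv g g <= _); last by lra.
by rewrite ler_wpM2r ?dotv_ge0.
Qed.

End gradient_step.

(** * Sensitivity of the last iterate *)

Section sensitivity.
Context (R : realType) (n m : nat) (m_gt0 : (0 < m)%N) (Z : Type).
Variables (loss : 'rV[R]_n -> Z -> R) (L beta eta : R) (w0 : 'rV[R]_n).
Hypotheses (L_gt0 : 0 < L) (beta_gt0 : 0 < beta).
Hypotheses (eta_gt0 : 0 < eta) (eta_le : eta <= 2 / beta).
Hypothesis loss_convex : forall z, convex1 (loss^~ z).
Hypothesis loss_lipschitz : forall z, elipschitz L (loss^~ z).
Hypothesis loss_smooth : forall z, smooth beta (loss^~ z).
Local Notation iter S s t := (psgd m_gt0 loss (fun=> eta) w0 S s t).

Lemma psgd_sensitivity (S S' : m.-tuple Z) (s : 'S_m) k : neighboring S S' ->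
  enorm (iter S s (k * m) - iter S' s (k * m)) <= 2 * k%:R * L * eta.
Proof.
(* [c] is chosen so that [m] divides [t.+1 + c] exactly when [t %% m = s i], that is, when step
   [t.+1] processes entry [i]. *)
case=> i _ eqS; pose c := (m.-1 - s i)%N.
have mc : (m = (s i + c).+1)%N.
  by rewrite subnKC ?prednK// -ltnS prednK.
(* (t + c) %/ m is the number of steps up to t that process the entry i. *)
have bound t : enorm (iter S s t - iter S' s t)
    <= ((t + c) %/ m)%:R * (2 * L * eta).
  elim: t => [|t IH].
    by rewrite subrr -[0](scale0r 0) enormZ normr0 mul0r mulr_ge0// !mulr_ge0// ltW.
  rewrite addSn divnS//=.
  set o := Ordinal _; set u := iter S s t in IH *; set v := iter S' s t in IH *.
  (* On any other entry both runs step along the same loss function, so the distance does not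
     grow. *)
  have [oE|o_neq] := eqVneq ((s^-1)%g o) i; last first.
    rewrite -eqS//; apply: le_trans (_ : _ <= enorm (u - v)) _.
      exact: (gradient_step_nonexpansive (loss_convex _) beta_gt0 (loss_smooth _)).
    apply: (le_trans IH); rewrite ler_wpM2r ?ler_nat ?leq_addl//.
    by rewrite !mulr_ge0// ltW.
  (* On entry [i] the count rises by one, and the two gradients, each of norm at most [L], add at
     most [2 * L * eta]. *)
  have -> : (m %| (t + c).+1)%N.
    have tE : (t %% m = s i)%N by rewrite -oE permKV.
    rewrite (divn_eq t m) tE -!addnA -addnS -[(s i + c).+1]mc.
    by rewrite dvdn_add ?dvdn_mull.
  rewrite natrD mulrDl mul1r [leRHS]addrC.
  set g := gradient _ u; set g' := gradient _ v.
  have -> : u - eta *: g - (v - eta *: g') = (u - v) + (- (eta *: g) + eta *: g').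
    by apply/rowP => j; rewrite !mxE; ring.
  apply: le_trans (enormD _ _) _; apply: lerD => //.
  apply: le_trans (enormD _ _) _; rewrite enormN !enormZ gtr0_norm//.
  have gL : enorm g <= L by exact: enorm_gradient_le.
  have g'L : enorm g' <= L by exact: enorm_gradient_le.
  rewrite -mulrDr mulrC ler_wpM2r ?(ltW eta_gt0)//; lra.
apply: le_trans (bound _) _.
(* Since [c < m], the count at [t = k * m] is exactly [k]. *)
rewrite divnMDl// divn_small ?addn0; last by rewrite [X in (_ < X)%N]mc ltnS leq_addl.
by rewrite le_eqVlt; apply/orP; left; apply/eqP; ring.
Qed.

End sensitivity.

(** * Translation invariance of Lebesgue measure *)

Section translation.
Context (R : realType).

(** The pushforward under the shift agrees with Lebesgue measure on half-open intervals, which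
    determine the measure. *)
Lemma lebesgue_measure_translation (a : R) (A : set R) : measurable A ->
  lebesgue_measure ((fun x : measurableTypeR R => x + a) @^-1` A) =
  lebesgue_measure A.
Proof.
have mD : measurable_fun [set: measurableTypeR R]
    (fun x : measurableTypeR R => x + a : measurableTypeR R).
  exact: measurable_funD.
pose mu := measure_function_pushforward__canonical__measure_function_Measure
  (@lebesgue_measure R) mD.
move=> mA; apply/esym/(@lebesgue_measure_unique R mu) => //= _ [[b c]] _ <-.
rewrite /mu/= /pushforward (_ : _ @^-1` _ = `]b - a, c - a]%classic).
  by rewrite !lebesgue_measure_itv/= !lte_fin ltrD2r -!EFinD opprB addrA subrK.
by apply/seteqP; split => x /=; rewrite !in_itv/= ltrBlDr lerBrDr.
Qed.

Lemma ge0_integral_lebesgue_translation (a : R) (f : measurableTypeR R -> \bar R) :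
  measurable_fun setT f -> (forall x, 0 <= f x)%E ->
  (\int[lebesgue_measure]_x f (x + a)%R = \int[lebesgue_measure]_x f x)%E.
Proof.
move=> mf f0.
have mD : measurable_fun [set: measurableTypeR R]
    (fun x : measurableTypeR R => x + a : measurableTypeR R).
  exact: measurable_funD.
have := @ge0_integral_pushforward _ _ _ _ R _ mD (@lebesgue_measure R) setT f
  measurableT mf (fun x _ => f0 x).
rewrite preimage_setT => <-; apply: eq_measure_integral => A mA _.
exact: lebesgue_measure_translation.
Qed.

Lemma measurable_rV_translation n (a : 'rV[R]_n) :
  measurable_fun [set: 'rV[R]_n] (fun v => v + a).
Proof.
apply/measurable_fun_rVP => i.
rewrite (_ : (fun v => _) = (fun v : 'rV[R]_n => v 0 i + a 0 i)).
  apply: measurable_funD => //.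
  exact: measurable_coord_rV.
by apply/funext => v; rewrite mxE.
Qed.

Lemma rV_consD n x y (u v : 'rV[R]_n) :
  rV_cons (x, u) + rV_cons (y, v) = rV_cons (x + y, u + v).
Proof.
apply/rowP => i; rewrite mxE; case: (unliftP ord0 i) => [j|] ->.
  by rewrite !rV_consS mxE.
by rewrite !rV_cons0.
Qed.

Lemma rV_consK n (v : 'rV[R]_n.+1) :
  rV_cons (v 0 ord0, \row_j v 0 (lift ord0 j)) = v.
Proof.
apply/rowP => i; case: (unliftP ord0 i) => [j|] ->.
  by rewrite rV_consS mxE.
by rewrite rV_cons0.
Qed.

(** Induction on the dimension: the product measure integrates the measures of sections. The outer
    integral absorbs the shift of the first coordinate, and the induction hypothesis absorbs that of
    the tail in each section. *)
Lemma lebesgue_rV_translation n (a : 'rV[R]_n) A : measurable A ->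
  lebesgue_rV R n ((fun v => v + a) @^-1` A) = lebesgue_rV R n A.
Proof.
elim: n a A => [|n IH] a A mA.
  by congr (lebesgue_rV R 0 _); apply/funext => v /=; rewrite [_ + _]thinmx0 [v]thinmx0.
have mcA : measurable (@rV_cons R n @^-1` A).
  by rewrite -[X in measurable X]setTI; exact: measurable_rV_cons.
rewrite /= /lebesgue_rV_succ /pushforward /product_measure1.
rewrite -[in RHS](@ge0_integral_lebesgue_translation (a 0 ord0)) //; last first.
  exact: measurable_fun_xsection.
apply: eq_integral => x _ /=.
rewrite -[RHS](IH (\row_j a 0 (lift ord0 j))); last exact: measurable_xsection.
congr (lebesgue_rV R n _); rewrite !xsectionE.
by apply/funext => v /=; rewrite -[in LHS](rV_consK a) rV_consD.
Qed.

Lemma ge0_integral_rV_translation n (a : 'rV[R]_n) A (f : 'rV[R]_n -> \bar R) :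
  measurable A -> measurable_fun A f -> (forall x, 0 <= f x)%E ->
  (\int[lebesgue_rV R n]_(x in (fun v => v + a)%R @^-1` A) f (x + a)%R =
   \int[lebesgue_rV R n]_(x in A) f x)%E.
Proof.
move=> mA mf f0.
rewrite -(@ge0_integral_pushforward _ _ _ _ R _ (measurable_rV_translation a)
  (lebesgue_rV R n) A f)//.
apply: eq_measure_integral; first exact: measurable_rV_translation.
by move=> ? B mB _; exact: lebesgue_rV_translation.
Qed.

End translation.

(** * Privacy of the noise and mixing over permutations *)

Section randomization.
Context (R : realType) (dO : measure_display) (Omega : measurableType dO).
Variable P : probability Omega R.

Lemma density_translation n (X : {RV P >-> 'rV[R]_n}) p (a : 'rV[R]_n) A :
  has_density X p -> measurable A ->
  distribution P X ((fun v => v + a) @^-1` A) =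
  (\int[lebesgue_rV R n]_(x in A) (p (x - a))%:E)%E.
Proof.
move=> [mp p0 pX] mA; have mD := @measurable_rV_translation R n.
rewrite pX; last by rewrite -[X in measurable X]setTI; exact: mD.
rewrite -[RHS](@ge0_integral_rV_translation _ _ a)//; last 2 first.
- apply/measurable_EFinP/measurable_funTS.
  exact: (measurableT_comp mp (mD (- a))).
- by move=> x; rewrite lee_fin.
by under [RHS]eq_integral do rewrite addrK.
Qed.

(** By the triangle inequality [enorm (x - b) <= enorm (x - a) + Delta], so the shifted densities
    differ pointwise by a factor at most [expR eps]; the normalizing constant [c] cancels. *)
Lemma exp_enorm_noise_private n (X : {RV P >-> 'rV[R]_n}) (eps Delta : R)
    (a b : 'rV[R]_n) (A : set 'rV[R]_n) :
  0 < eps -> 0 < Delta ->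
  density_propto X (fun x => expR (- (eps * enorm x / Delta))) ->
  enorm (a - b) <= Delta -> measurable A ->
  (distribution P X ((fun v => v + a)%R @^-1` A) <=
   (expR eps)%:E * distribution P X ((fun v => v + b)%R @^-1` A))%E.
Proof.
move=> eps0 Delta0 [c c0 Xp] abD mA; have [mp _ _] := Xp.
rewrite !(density_translation _ Xp mA).
have mq u : measurable_fun A
    (fun x => (c * expR (- (eps * enorm (x - u) / Delta)))%:E).
  apply/measurable_EFinP/measurable_funTS.
  exact: (measurableT_comp mp (@measurable_rV_translation R n (- u))).
have q0 (u x : 'rV[R]_n) : (0 <= (c * expR (- (eps * enorm (x - u) / Delta)))%:E)%E.
  by rewrite lee_fin mulr_ge0 ?expR_ge0// ltW.
rewrite -(ge0_integralZl _ mA (mq b))//.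
apply: ge0_le_integral => //; first exact: measurable_funeM.
move=> x _; rewrite -EFinM lee_fin mulrCA ler_pM2l// -expRD ler_expR.
have : enorm (x - b) <= enorm (x - a) + enorm (a - b).
  by apply: le_trans (enormD _ _); rewrite addrA subrK.
move=> /le_trans/(_ (lerD (lexx _) abD)); rewrite -(ler_pM2l eps0).
rewrite mulrDr -(ler_pM2r (_ : 0 < Delta^-1)) ?invr_gt0// mulrDl mulfK ?gt_eqF//.
lra.
Qed.

(** Partition by the finitely many values of [r]; on each piece the event about [X] is fixed, so
    independence factors its probability. *)
Lemma independent_perm_mixture d (T : measurableType d) m
    (r : {RV P >-> 'S_m}) (X : {RV P >-> T}) (A : 'S_m -> set T) :
  independent_RV r X -> (forall s, measurable (A s)) ->
  P [set omega | A (r omega) (X omega)] =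
  \sum_(s \in [set: 'S_m]) (distribution P r [set s] * distribution P X (A s))%E.
Proof.
move=> indep mA; have m1 (s : 'S_m) : measurable [set s] by [].
pose F s := r @^-1` [set s] `&` X @^-1` A s.
have -> : [set omega | A (r omega) (X omega)] = \bigcup_(s in setT) F s.
  apply/seteqP; split => [w Aw|w [s _ [/= -> //]]].
  by exists (r w).
have trivF : trivIset setT F by move=> s t _ _ [w [[/= <- _] [/= <- _]]].
have mF s : measurable (F s).
  by apply: measurableI; rewrite -[X in measurable X]setTI; exact: measurable_funP.
rewrite measure_fin_bigcup//; last exact: finite_finset.
by apply: eq_fsbigr => s _; exact: indep.
Qed.

End randomization.

Theorem theorem4 (R : realType) (d m k : nat)
    (d_gt0 : (0 < d)%N) (m_gt0 : (0 < m)%N) (k_gt0 : (0 < k)%N)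
    (L beta eps eta : R)
    (L_gt0 : 0 < L) (beta_gt0 : 0 < beta) (eps_gt0 : 0 < eps)
    (eta_gt0 : 0 < eta) (eta_le : eta <= 2 / beta)
    (Z : Type) (loss : 'rV[R]_d -> Z -> R)
    (loss_diff : forall z w, differentiable (loss^~ z) w)
    (loss_convex : forall z, convex1 (loss^~ z))
    (loss_lipschitz : forall z, elipschitz L (loss^~ z))
    (loss_smooth : forall z, smooth beta (loss^~ z))
    (w0 : 'rV[R]_d)
    (dO : measure_display) (Omega : measurableType dO)
    (P : probability Omega R)
    (r : {RV P >-> 'S_m}) (kappa : {RV P >-> 'rV[R]_d})
    (r_uniform : uniform_perm r)
    (r_kappa_indep : independent_RV r kappa)
    (kappa_density : let Delta2 := 2 * k%:R * L * eta in
       density_propto kappa (fun x => expR (- (eps * enorm x / Delta2)))) :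
  differentially_private eps
    (fun S => distribution P (private_psgd k m_gt0 loss eta w0 r kappa S)).
Proof.
move=> S S' SS' E mE; set Delta := 2 * k%:R * L * eta.
have Delta0 : 0 < Delta by rewrite !mulr_gt0 ?ltr0n.
pose w S s := psgd m_gt0 loss (fun=> eta) w0 S s (k * m).
(* For a fixed permutation the output is the noise shifted by a deterministic last iterate. *)
pose mix T := \sum_(s \in [set: 'S_m]) (distribution P r [set s] *
  distribution P kappa ((fun v => v + w T s)%R @^-1` E))%E.
have law T : distribution P (private_psgd k m_gt0 loss eta w0 r kappa T) E =
    mix T.
  rewrite /mix -(independent_perm_mixture r_kappa_indep).
    congr (P _); apply/funext => omega /=.
    by rewrite /private_psgd addrC.
  move=> s; rewrite -[X in measurable X]setTI.
  exact: measurable_rV_translation.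
suff : (mix S <= (expR eps)%:E * mix S')%E by rewrite -!law.
rewrite /mix ge0_mule_fsumr; last by move=> s; rewrite mule_ge0.
apply: lee_fsum => [|s _]; first exact: finite_finset.
(* Both mixtures give [s] the same weight, so it suffices to compare the two shifted noise laws for
   each [s]. *)
rewrite muleCA lee_wpmul2l//.
apply: exp_enorm_noise_private kappa_density _ mE => //.
exact: (psgd_sensitivity _ _ L_gt0 beta_gt0).
Qed.
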